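(* Suppose that there is a finite group $G$ having a partition $\mathcal{P}=\{\{1_G\},P_1,P_2,\dots,P_n\}$ where all the $P_i$ are Latin square type partial difference sets or all are negative Latin square type partial difference sets, and $1_G$ is the identity of $G$. Let $G'$ be any other finite group, and suppose $D$ is a partial difference set in $G\times G'$ which is constructed as a union of sets of the form $A_ix_i'=\{(a,x_i'):a\in A_i\}$ with $A_i\in\mathcal{P}$, $x_i'\in G'$. Suppose there is another group $\widehat{G}$ that has a partition of its nonidentity elements into partial difference sets $\{\widehat{P_1},\widehat{P_2},\dots,\widehat{P_n}\}$ where $P_i$ and $\widehat{P_i}$ have the same parameters for all $i$. If the set $\widehat{D}\subset\widehat{G}\times G'$ is defined from $D$ by replacing each $P_i$ with $\widehat{P_i}$ and $1_G$ with $1_{\widehat{G}}$, then $\widehat{D}$ is a partial difference set in $\widehat{G}\times G'$ with the same parameters as $D$.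
   Context: A $(v,k,\lambda,\mu)$-partial difference set (PDS) in a finite group $G$ of order $v$ is a subset $D$ with $|D|=k$ such that every nonidentity element of $D$ can be written as $d_1d_2^{-1}$ with $d_1,d_2\in D$ in exactly $\lambda$ ways, and every nonidentity element of $G-D$ in exactly $\mu$ ways. PDSs are assumed regular: $1_G\notin D$ and $D=D^{-1}$. A PDS is of Latin square type if its parameters are $(n^2,r(n-1),n+r^2-3r,r^2-r)$ for some natural number $r$, and of negative Latin square type if they are $(n^2,r(n+1),-n+r^2+3r,r^2+r)$ for some natural number $r$. *)

(* Defs.v *)
From HB Require Import structures.
From mathcomp Require Import all_boot all_order all_fingroup all_algebra.

Set Implicit Arguments.
Unset Strict Implicit.
Unset Printing Implicit Defensive.

Import GRing.Theory.

Definition diff_count (gT : finGroupType) (D : {set gT}) (x : gT) : nat :=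
  #|[set d in setX D D | (d.1 * d.2^-1)%g == x]|.

(* The ambient group is the whole type gT. *)
Definition partial_difference_set (gT : finGroupType) (D : {set gT})
    (v k lambda mu : nat) : Prop :=
  [/\ #|[set: gT]| = v,
      #|D| = k,
      forall x, x \in D -> x != 1%g -> diff_count D x = lambda
    & forall x, x \notin D -> x != 1%g -> diff_count D x = mu].

Definition regular_subset (gT : finGroupType) (D : {set gT}) : Prop :=
  1%g \notin D /\ (D^-1)%g = D.

Definition pds (gT : finGroupType) (D : {set gT}) (v k lambda mu : nat)
    : Prop :=
  partial_difference_set D v k lambda mu /\ regular_subset D.

(* The parameters are natural numbers, but the formulas below involve
   subtraction, so the equations between them are stated in int. *)
Definition latin_square_type (gT : finGroupType) (D : {set gT}) : Prop :=
  exists n r v k lambda mu : nat, pds D v k lambda mu /\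
    [/\ v%:Z = n%:Z ^+ 2,
        k%:Z = r%:Z * (n%:Z - 1),
        lambda%:Z = n%:Z + r%:Z ^+ 2 - 3 * r%:Z
      & mu%:Z = r%:Z ^+ 2 - r%:Z]%R.

Definition negative_latin_square_type (gT : finGroupType) (D : {set gT})
    : Prop :=
  exists n r v k lambda mu : nat, pds D v k lambda mu /\
    [/\ v%:Z = n%:Z ^+ 2,
        k%:Z = r%:Z * (n%:Z + 1),
        lambda%:Z = - n%:Z + r%:Z ^+ 2 + 3 * r%:Z
      & mu%:Z = r%:Z ^+ 2 + r%:Z]%R.

(* The members of {{1}, P_1, ..., P_n}: None stands for {1}, Some i for P_i. *)
Definition part (gT : finGroupType) (n : nat) (P : 'I_n -> {set gT})
    (a : option 'I_n) : {set gT} :=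
  if a is Some i then P i else [set 1%g].

(* The union of the sets A x', where the pair (a, x') in S codes A x' with
   A = part P a; the same S read with another family P performs the
   replacement of every P_i, and of the identity. *)
Definition union_of_parts (gT kT : finGroupType) (n : nat)
    (P : 'I_n -> {set gT}) (S : {set option 'I_n * kT}) : {set gT * kT} :=
  \bigcup_(s in S) setX (part P s.1) [set s.2].

(* Main.v *)
Require Import Defs.
From mathcomp Require Import all_boot all_order all_fingroup all_algebra.
From mathcomp Require Import ring.

(** The sets [P i] turn out to span, together with the identity, a Schur ring
whose structure constants are given by a formula in the parameters alone. As
the [Phat i] have the same parameters, they obey the same formula, and the
number of ways to write an element of [kT]-coordinate [x] and label [a] as a
difference in [union_of_parts P S] is a sum of structure constants indexed by
[S], [x] and [a]: it cannot tell [P] from [Phat].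

The two types are treated at once. With [m := n, s := r] for the Latin square
type and [m := - n, s := - r] for the negative one, both sets of parameters
read [(m^2, s (m - 1), m + s^2 - 3 s, s^2 - s)]
([signed_square_type], [common_signed_square_type]).

Let [A_i] be the 0/1 matrix of the relation [x y^-1 \in P i] and [J] the
all-ones matrix. If [P i] has these parameters, with [s_i] for [s], then on the
complement of the all-ones vector [A_i] has no eigenvalues but [m - s_i] and
[- s_i]; hence
[B_i := m A_i + m s_i I - s_i J] is symmetric with [B_i^2 = m^2 B_i]: up to a
factor it is an orthogonal projector. Counting elements gives
[\sum_i s_i = m + 1], so that [\sum_i B_i = m^2 I - J], which acts as [m^2 I] on
every [B_j]. Symmetric idempotents whose sum is an identity are pairwise
orthogonal ([symmetric_idempotents_orthogonal]), so [B_i B_j = 0] for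
[i != j]. In particular the [A_i] commute, even in a nonabelian group.
Expanding [B_i B_j] yields
[A_i A_j = s_i s_j (J - I) - s_j A_i - s_i A_j + (i == j) B_i], whose entries
are the structure constants ([pair_count_part]). The theorem then follows by
sorting the pairs counted by [diff_count] according to the parts that contain
their coordinates ([diff_count_union_of_parts]). *)

Set Implicit Arguments.
Unset Strict Implicit.
Unset Printing Implicit Defensive.

Import Order.TTheory GRing.Theory Num.Theory.

Local Open Scope ring_scope.

(** * Orthogonality of symmetric idempotents *)

Section MatrixIdempotents.

Variable R : realDomainType.

Lemma trmx_mul_trace_eq0 p q (A : 'M[R]_(p, q)) :
  \tr (A^T *m A) = 0 -> A = 0.
Proof.
have sq_ge0 j i : 0 <= A^T j i * A i j by rewrite mxE -expr2 sqr_ge0.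
rewrite /mxtrace => trA0; apply/matrixP => i j; rewrite [RHS]mxE.
have colj : (A^T *m A) j j = 0.
  apply: (psumr_eq0P _ trA0) => // l _.
  by rewrite mxE sumr_ge0.
move: colj; rewrite mxE => /psumr_eq0P/(_ i isT).
by rewrite mxE => /(_ (fun l _ => sq_ge0 _ _))/eqP; rewrite mulf_eq0 orbb => /eqP.
Qed.

Lemma mxtrace_trmx_mul_ge0 p q (A : 'M[R]_(p, q)) : 0 <= \tr (A^T *m A).
Proof.
apply: sumr_ge0 => j _; rewrite mxE; apply: sumr_ge0 => i _.
by rewrite mxE -expr2 sqr_ge0.
Qed.

(** Multiplying [\sum_(l | l != i) B_i B_l = 0] by [B_i] on the right, and using
[a B_l = B_l^2], turns each term into a Gram matrix [(B_l B_i)^T (B_l B_i)].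
The traces of these are nonnegative and sum to 0, so each vanishes.
Idempotents are taken up to a scalar [a] to stay within the integers. *)
Lemma symmetric_idempotents_orthogonal (I : finType) p (a : R)
    (B : I -> 'M[R]_p) :
  a != 0 ->
  (forall i, (B i)^T = B i) ->
  (forall i, B i *m B i = a *: B i) ->
  (forall i, B i *m (\sum_j B j) = a *: B i) ->
  forall i j, i != j -> B i *m B j = 0.
Proof.
move=> a0 symB idB sumB i j neq_ij.
have off0 : \sum_(l | l != i) B i *m B l = 0.
  have := sumB i; rewrite (bigD1 i) //= mulmxDr idB mulmx_sumr.
  by move/eqP; rewrite -[X in _ == X]addr0 (inj_eq (addrI _)) => /eqP.
have tr0 : \sum_(l | l != i) \tr ((B l *m B i)^T *m (B l *m B i)) = 0.
  rewrite -raddf_sum /=.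
  rewrite (eq_bigr (fun l => a *: (B i *m B l *m B i))) => [|l _].
    by rewrite -scaler_sumr -mulmx_suml off0 mul0mx scaler0 raddf0.
  rewrite trmx_mul !symB mulmxA -(mulmxA (B i) (B l) (B l)) idB.
  by rewrite -scalemxAr -scalemxAl ?mulmxA.
have /trmx_mul_trace_eq0 BjBi0 : \tr ((B j *m B i)^T *m (B j *m B i)) = 0.
  apply: (psumr_eq0P _ tr0) => [l _|]; last by rewrite eq_sym.
  exact: mxtrace_trmx_mul_ge0.
by apply: trmx_inj; rewrite trmx_mul !symB BjBi0 trmx0.
Qed.

End MatrixIdempotents.

(** * Difference counts as matrix products *)

(** The version of [diff_count] for two sets, to which it specializes by
conversion when the sets are equal. *)
Definition pair_count (gT : finGroupType) (D E : {set gT}) (x : gT) : nat :=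
  #|[set d in setX D E | (d.1 * d.2^-1)%g == x]|.

Section DifferenceMatrix.

Variable gT : finGroupType.
Implicit Types (D E : {set gT}) (x : gT).

Definition diff_mx D : 'M[int]_#|gT| :=
  \matrix_(i, j) (enum_val i * (enum_val j)^-1 \in D)%g%:R.

Lemma sum_enum_val (F : gT -> int) :
  \sum_(i < #|gT|) F (enum_val i) = \sum_x F x.
Proof. by rewrite -(big_enum_val (A := gT) F). Qed.

(** The product sums over the third vertex [y] of a path from [u] to [w];
[y] corresponds to the pair [(u y^-1, w y^-1)], of difference [u w^-1]. *)
Lemma diff_mxM D E (i j : 'I_#|gT|) :
  (diff_mx D *m (diff_mx E)^T) i j =
  (pair_count D E (enum_val i * (enum_val j)^-1)%g)%:R.
Proof.
rewrite mxE; set u := enum_val i; set w := enum_val j.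
rewrite (eq_bigr (fun l => ((u * (enum_val l)^-1 \in D)%g
    && (w * (enum_val l)^-1 \in E)%g)%:R)) => [|l _]; last first.
  by rewrite !mxE -natrM mulnb.
rewrite (sum_enum_val (fun y => ((u * y^-1 \in D) && (w * y^-1 \in E))%g%:R)).
rewrite -natr_sum -big_mkcond /= sum1dep_card; congr (_%:R).
rewrite -(card_imset (f := fun y => (u * y^-1, w * y^-1)%g)); last first.
  by move=> y z [/mulgI/invg_inj].
apply: eq_card => -[d e]; rewrite !inE /=; apply/imsetP/andP.
  case=> y; rewrite inE => /andP[Dy Ey] [-> ->]; rewrite Dy Ey; split=> //.
  by rewrite invMg invgK mulgA mulgKV.
case=> /andP[Dd Ee] /eqP de.
have we : (w * (d^-1 * u)^-1 = e)%g.
  rewrite invMg invgK mulgA -[(w * u^-1)%g]invgK invMg invgK -de.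
  by rewrite invMg invgK mulgKV.
exists (d^-1 * u)%g; last by rewrite we invMg invgK mulKVg.
by rewrite inE we Ee invMg invgK mulKVg Dd.
Qed.

End DifferenceMatrix.

(** * The projector attached to a partial difference set *)

(** Parameters of Latin square type when [m] and [s] are nonnegative, and of
negative Latin square type when they are nonpositive. *)
Definition signed_square_type (gT : finGroupType) (m s : int) (D : {set gT})
    : Prop :=
  exists v k lambda mu : nat, pds D v k lambda mu /\
    [/\ v%:Z = m ^+ 2, k%:Z = s * (m - 1),
        lambda%:Z = m + s ^+ 2 - 3 * s & mu%:Z = s ^+ 2 - s].

Section Projectors.

Variable gT : finGroupType.
Implicit Types (D E : {set gT}) (x : gT) (m s t : int).

Local Notation J := (const_mx 1 : 'M[int]_#|gT|).

(** [m^2] times the projector onto the eigenspace of [m - s] in the orthogonal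
complement of the all-ones vector, for [D] of parameters given by [m] and
[s]. *)
Definition projector_mx m s D : 'M[int]_#|gT| :=
  m *: diff_mx D + (m * s)%:M - s *: J.

Lemma diff_mx_tr D : (diff_mx D)^T = diff_mx D^-1%g.
Proof.
by apply/matrixP => i j; rewrite !mxE inE invMg invgK.
Qed.

Lemma diff_mx1 : diff_mx [set 1%g : gT] = 1%:M.
Proof.
apply/matrixP => i j; rewrite !mxE inE -eq_mulgV1.
by rewrite (inj_eq enum_val_inj).
Qed.

Lemma diff_mxJ D : diff_mx D *m J = #|D|%:R *: J.
Proof.
apply/matrixP => i j; rewrite !mxE mulr1.
under eq_bigr do rewrite !mxE mulr1.
rewrite (sum_enum_val (fun y => (enum_val i * y^-1 \in D)%g%:R)).
rewrite -natr_sum -big_mkcond /= sum1dep_card; congr (_%:R).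
rewrite -(card_imset (f := fun y => (enum_val i * y^-1)%g)); last first.
  by move=> y z /mulgI/invg_inj.
apply: eq_card => y; apply/imsetP/idP => [[z]|Dy].
  by rewrite inE => Dz ->.
by exists (y^-1 * enum_val i)%g; rewrite ?inE invMg invgK mulKVg.
Qed.

Lemma J_diff_mx D : J *m diff_mx D = #|D|%:R *: J.
Proof.
apply: trmx_inj; rewrite trmx_mul diff_mx_tr linearZ /= trmx_const diff_mxJ.
by rewrite card_invg.
Qed.

Lemma JJ : J *m J = #|gT|%:R *: J.
Proof.
apply/matrixP => i j; rewrite !mxE mulr1.
under eq_bigr do rewrite !mxE mulr1.
by rewrite sumr_const card_ord.
Qed.

(** Every count is a matrix entry: the row of [x] and the column of 1 serve for
all sets at once. *)
Lemma pair_count_mx D E x : exists i j,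
  (diff_mx D *m (diff_mx E)^T) i j = (pair_count D E x)%:R /\
  forall F, diff_mx F i j = (x \in F)%:R.
Proof.
exists (enum_rank x), (enum_rank 1%g); rewrite diff_mxM !enum_rankK.
by rewrite invg1 mulg1; split=> // F; rewrite mxE !enum_rankK invg1 mulg1.
Qed.

(** As [#|D| + s = s m], [#|E| + t = t m] and [#|gT| = m^2], the three products
that involve [J] are [- m^2 s t J] twice and [m^2 s t J] once. *)
Lemma projector_mxM m s t D E :
  #|gT|%:Z = m ^+ 2 -> #|D|%:Z = s * (m - 1) -> #|E|%:Z = t * (m - 1) ->
  projector_mx m s D *m projector_mx m t E =
  m ^+ 2 *: (diff_mx D *m diff_mx E + t *: diff_mx D + s *: diff_mx E
             + (s * t)%:M - (s * t) *: J).
Proof.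
move=> vE kD kE; rewrite /projector_mx.
rewrite !(mulmxDl, mulmxDr, mulNmx, mulmxN).
rewrite -!(scalemxAl, scalemxAr) !(mul_scalar_mx, mul_mx_scalar).
rewrite diff_mxJ J_diff_mx JJ.
move: (diff_mx D *m diff_mx E) => X.
rewrite !natz vE kD kE; apply/matrixP => i j; rewrite !mxE.
by case: (i == j); rewrite ?mulr1n ?mulr0n; ring.
Qed.

Lemma projector_mx_tr m s D :
  (D^-1)%g = D -> (projector_mx m s D)^T = projector_mx m s D.
Proof.
move=> symD; rewrite /projector_mx.
rewrite linearB linearD !linearZ /= diff_mx_tr symD tr_scalar_mx trmx_const //.
Qed.

Lemma projector_mxJ m s D :
  #|gT|%:Z = m ^+ 2 -> #|D|%:Z = s * (m - 1) -> projector_mx m s D *m J = 0.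
Proof.
move=> vE kD; rewrite /projector_mx mulmxBl mulmxDl -!scalemxAl diff_mxJ JJ.
rewrite mul_scalar_mx !natz vE kD; apply/matrixP => i j; rewrite !mxE; ring.
Qed.

Lemma pair_count1 D : pair_count D D 1%g = #|D|.
Proof.
rewrite -(card_imset (f := fun x : gT => (x, x))); last by move=> x y [].
apply: eq_card => -[d e]; rewrite !inE /= -eq_mulgV1; apply/andP/imsetP.
  by case=> /andP[Dd _] /eqP <-; exists d.
by case=> x Dx [-> ->]; rewrite Dx eqxx.
Qed.

Lemma pds_diff_mxM D v k lambda mu :
  pds D v k lambda mu ->
  diff_mx D *m diff_mx D =
  k%:Z%:M + lambda%:Z *: diff_mx D + mu%:Z *: (J - 1%:M - diff_mx D).
Proof.
move=> [[_ kD lamD muD] [nD1 symD]].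
rewrite -{2}symD -diff_mx_tr; apply/matrixP => i j; rewrite diff_mxM !mxE.
set x := (enum_val i * (enum_val j)^-1)%g.
have -> : (i == j) = (x == 1%g).
  by rewrite /x -eq_mulgV1 (inj_eq enum_val_inj).
have [-> | x1] := eqVneq x 1%g.
  by rewrite (negPf nD1) pair_count1 kD natz !mulr0n !mulr1n; ring.
rewrite -[pair_count D D x]/(diff_count D x).
case: (boolP (x \in D)) => Dx; [rewrite lamD // | rewrite muD //].
  by rewrite natz !mulr0n !mulr1n; ring.
by rewrite natz !mulr0n; ring.
Qed.

End Projectors.

(** * Structure constants of a partition of square type *)

(** A partition into the sets [part P a] is handled through the function [c]
that sends an element to the index of its part. *)
Section StructureConstants.

Variables (gT : finGroupType) (n : nat) (P : 'I_n -> {set gT}).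
Variables (c : gT -> option 'I_n) (m : int) (s : 'I_n -> int).
Hypothesis partE : forall a x, (x \in part P a) = (c x == a).
Hypothesis c_surj : forall a, exists x, c x = a.
Hypothesis typeP : forall i, signed_square_type m (s i) (P i).

Lemma labelled_in i x : (x \in P i) = (c x == Some i).
Proof. exact: (partE (Some i)). Qed.

Lemma label_eq_None x : (c x == None) = (x == 1%g).
Proof. by rewrite -partE inE. Qed.

Lemma square_type_order (i : 'I_n) : #|gT|%:Z = m ^+ 2.
Proof.
by have [v [k [l [u [[[<- _ _ _] _] [<- _ _ _]]]]]] := typeP i; rewrite cardsT.
Qed.

Lemma square_type_card i : #|P i|%:Z = s i * (m - 1).
Proof. by have [v [k [l [u [[[_ <- _ _] _] []]]]]] := typeP i. Qed.

Lemma square_type_sym i : ((P i)^-1)%g = P i.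
Proof. by have [v [k [l [u [[_ []]]]]]] := typeP i. Qed.

Lemma square_type_m_neq0 (i : 'I_n) : m != 0.
Proof.
have := square_type_order i; case: eqP => // -> /eqP.
by rewrite expr0n /= eqz_nat -cardsT (cardD1 1%g) inE.
Qed.

Lemma square_type_m_neq1 (i : 'I_n) : m - 1 != 0.
Proof.
have := square_type_card i; case: eqP => // ->; rewrite mulr0 => /eqP.
rewrite eqz_nat cards_eq0; have [x /eqP] := c_surj (Some i).
by rewrite -labelled_in => Px /eqP P0; rewrite P0 inE in Px.
Qed.

Lemma label_invg x : c x^-1%g = c x.
Proof.
apply/eqP; rewrite -partE; case E: (c x) => [i|] /=.
  by rewrite -(square_type_sym i) inE invgK labelled_in E.
by rewrite inE eq_invg1 -label_eq_None E.
Qed.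

Lemma labelled_sum_diff_mx :
  \sum_i diff_mx (P i) = const_mx 1 - 1%:M :> 'M[int]_#|gT|.
Proof.
rewrite -diff_mx1; apply/matrixP => i j; rewrite summxE !mxE inE.
under eq_bigr do rewrite mxE labelled_in.
rewrite -label_eq_None; case: (c _) => [l|] /=.
  rewrite (bigD1 l) //= eqxx big1 ?subr0 ?addr0 // => l' /negPf.
  by rewrite eq_sym => nl; rewrite -[_ == _]/(l == l') nl.
by rewrite big1.
Qed.

Lemma labelled_card : #|gT| = (1 + \sum_i #|P i|)%N.
Proof.
rewrite -sum1_card (bigD1 1%g) //=; congr (1 + _)%N.
rewrite (eq_bigr (fun x => \sum_i (c x == Some i) : nat)%N) => [|x].
  rewrite exchange_big /=.
  apply: eq_bigr => i _; rewrite -sum1_card big_mkcond [RHS]big_mkcond /=.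
  apply: eq_bigr => x _; rewrite labelled_in.
  have [->|_] := eqVneq x 1%g; last by case: eqP.
  by move: (label_eq_None 1%g); rewrite eqxx => /eqP ->.
rewrite -label_eq_None; case: (c x) => // l _.
rewrite (bigD1 l) //= eqxx big1 // => l' /negPf.
by rewrite eq_sym => nl; rewrite -[_ == _]/(l == l') nl.
Qed.

(** Compare [m^2 - 1], the number of nonidentity elements, with the sum of the
[s i * (m - 1)], and cancel [m - 1]. *)
Lemma square_type_sum (i0 : 'I_n) : \sum_i s i = m + 1.
Proof.
apply: (mulIf (square_type_m_neq1 i0)).
rewrite mulr_suml -(eq_bigr _ (fun i _ => square_type_card i)).
have -> : \sum_i #|P i|%:Z = (\sum_i #|P i|)%N%:Z.
  by rewrite -natz natr_sum; apply: eq_bigr => i _; rewrite natz.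
have := square_type_order i0; rewrite labelled_card PoszD => vE.
by rewrite -[LHS](addKr 1%:Z) vE; ring.
Qed.

(** [m + s^2 - 3 s - (s^2 - s) = m - 2 s] and [s (m - 1) - (s^2 - s) = s (m - s)]
say that [m - s] and [- s] are the roots of the quadratic equation of the
[diff_mx]. *)
Lemma projector_mx_idem i :
  projector_mx m (s i) (P i) *m projector_mx m (s i) (P i) =
  m ^+ 2 *: projector_mx m (s i) (P i).
Proof.
rewrite projector_mxM ?(square_type_order i) ?square_type_card //.
have [v [k [l [u [pdsP [_ kE lE uE]]]]]] := typeP i.
rewrite (pds_diff_mxM pdsP) kE lE uE; congr (_ *: _).
apply/matrixP => p q; rewrite !mxE.
by case: (p == q); rewrite ?mulr1n ?mulr0n; ring.
Qed.

Lemma projector_mx_sum (i0 : 'I_n) :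
  \sum_i projector_mx m (s i) (P i) = (m ^+ 2)%:M - const_mx 1.
Proof.
rewrite /projector_mx big_split big_split /= -scaler_sumr labelled_sum_diff_mx.
rewrite sumrN -scaler_suml -raddf_sum -mulr_sumr (square_type_sum i0).
apply/matrixP => p q; rewrite !mxE.
by case: (p == q); rewrite ?mulr1n ?mulr0n; ring.
Qed.

(** By [projector_mx_sum] the sum of the projectors acts on each of them as
[m^2], since [J] annihilates them. *)
Lemma projector_mx_orthogonal i j : i != j ->
  projector_mx m (s i) (P i) *m projector_mx m (s j) (P j) = 0.
Proof.
apply: (symmetric_idempotents_orthogonal (a := m ^+ 2)
  (B := fun l => projector_mx m (s l) (P l))) => [|l|l|l].
- by rewrite expf_neq0 // (square_type_m_neq0 i).
- by rewrite projector_mx_tr // square_type_sym.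
- exact: projector_mx_idem.
rewrite (projector_mx_sum i) mulmxBr mul_mx_scalar.
rewrite projector_mxJ ?subr0 ?square_type_card //.
exact: (square_type_order i).
Qed.

End StructureConstants.

(** The coefficient of the part [e] in the product of the parts [a] and [b]. For
two genuine parts it reads off
[A_i A_j = s_i s_j (J - I) - s_j A_i - s_i A_j + (i == j) B_i]. *)
Definition structure_constant n (m : int) (s : 'I_n -> int)
    (a b e : option 'I_n) : int :=
  match a, b with
  | None, _ => (e == b)%:R
  | Some _, None => (e == a)%:R
  | Some i, Some j =>
      s i * s j * (e != None)%:R - s j * (e == a)%:R - s i * (e == b)%:R
      + (a == b)%:R * (m * (e == a)%:R + m * s i * (e == None)%:R - s i)
  end.

(** The right-hand side sees the group and the partition only through [m], [s]
and the label of [x]; this is what lets one partition replace another. *)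
Lemma pair_count_part (gT : finGroupType) n (P : 'I_n -> {set gT})
    (c : gT -> option 'I_n) (m : int) (s : 'I_n -> int) :
  (forall a x, (x \in part P a) = (c x == a)) ->
  (forall a, exists x, c x = a) ->
  (forall i, signed_square_type m (s i) (P i)) ->
  forall a b x, (pair_count (part P a) (part P b) x)%:Z =
                structure_constant m s a b (c x).
Proof.
move=> partE c_surj typeP a b x.
have inP := labelled_in partE.
have sym_part e : (part P e)^-1%g = part P e.
  case: e => [i|] /=; first exact: (square_type_sym typeP).
  by apply/setP => y; rewrite !inE eq_invg1.
have [p [q [+ entryE]]] := pair_count_mx (part P a) (part P b) x.
rewrite diff_mx_tr sym_part natz => <-.
have oneE : (1%:M : 'M[int]_#|gT|) p q = (c x == None)%:R.
  by rewrite -diff_mx1 entryE inE (label_eq_None partE).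
case: a b => [i|] [j|];
  rewrite ?diff_mx1 ?mul1mx ?mulmx1 ?entryE ?partE ?oneE //=.
have m2_neq0 : m ^+ 2 != 0 by rewrite expf_neq0 // (square_type_m_neq0 typeP i).
have projM : projector_mx m (s i) (P i) *m projector_mx m (s j) (P j) =
    m ^+ 2 *: ((i == j)%:R *: projector_mx m (s i) (P i)).
  case: eqP => [<-|/eqP ij]; rewrite ?scale1r ?scale0r ?scaler0.
    exact: (projector_mx_idem typeP).
  exact: (projector_mx_orthogonal partE c_surj typeP).
have idE : (p == q) = (c x == None).
  by move: oneE; rewrite mxE; case: (p == q); case: (c x == None).
(* The sides of [projM], divided by [m ^+ 2], are compared at the entry [p q]. *)
move: projM; rewrite projector_mxM ?(square_type_order typeP i)
  ?(square_type_card typeP) // => /matrixP/(_ p q).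
rewrite mxE [RHS]mxE => /(mulfI m2_neq0); rewrite /projector_mx.
move: (_ *m _) (entryE (P i)) (entryE (P j)) => X.
move: (diff_mx (P i)) (diff_mx (P j)) => Ai Aj Aix Ajx.
rewrite !mxE Aix Ajx !inP idE.
rewrite (inj_eq (@Some_inj _)) mulr1 => XE.
apply: (addIr (s j * (c x == Some i)%:R + s i * (c x == Some j)%:R
  + (s i * s j) *+ (c x == None) - s i * s j)).
rewrite !addrA XE.
by case: (c x) => [l|]; rewrite ?mulr0n ?mulr1n /=; case: (i == j); ring.
Qed.

(** * Unions of parts in a product group *)

Section UnionOfParts.

Variables (gT kT : finGroupType) (n : nat) (P : 'I_n -> {set gT}).
Variable c : gT -> option 'I_n.
Hypothesis partE : forall a x, (x \in part P a) = (c x == a).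
Variable S : {set option 'I_n * kT}.

Lemma mem_union_of_parts (y : gT * kT) :
  (y \in union_of_parts P S) = ((c y.1, y.2) \in S).
Proof.
apply/bigcupP/idP => [[[a x] Sax]|Sy].
  by rewrite !inE /= partE => /andP[/eqP -> /eqP ->].
by exists (c y.1, y.2) => //; rewrite !inE /= partE !eqxx.
Qed.

(** The pairs are sorted by the elements of [S] that their two members come
from; the second coordinates are then determined. *)
Lemma diff_count_union_of_parts g x :
  diff_count (union_of_parts P S) (g, x) =
  (\sum_(st in setX S S | (st.1.2 * st.2.2^-1 == x)%g)
    pair_count (part P st.1.1) (part P st.2.1) g)%N.
Proof.
pose lab (d : (gT * kT) * (gT * kT)) :=
  ((c d.1.1, d.1.2), (c d.2.1, d.2.2)).
rewrite /diff_count -sum1_card.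
rewrite (partition_big lab (fun st => (st \in setX S S)
    && (st.1.2 * st.2.2^-1 == x)%g)) => [|[[g1 x1] [g2 x2]]]; last first.
  by rewrite !inE !mem_union_of_parts -andbA /= => /and3P[-> -> /eqP[_ ->]] /=.
apply: eq_bigr => -[[a x1] [b x2]] /andP[].
rewrite inE /= => /andP[Sa Sb] /eqP <-.
rewrite sum1dep_card /pair_count.
rewrite -(card_imset (f := fun d : gT * gT => ((d.1, x1), (d.2, x2)))); last first.
  by move=> [u1 u2] [w1 w2] [-> ->].
apply: eq_card => -[[g1 y1] [g2 y2]]; rewrite !inE !mem_union_of_parts /lab /=.
apply/idP/imsetP => [/andP[/andP[_ /eqP[gE _]] /eqP[<- -> <- ->]]|].
  by exists (g1, g2) => //; rewrite !inE /= !partE gE !eqxx.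
case=> -[u1 u2]; rewrite !inE /= !partE.
move=> /andP[/andP[/eqP cu1 /eqP cu2] /eqP gE].
by move=> [-> -> -> ->]; rewrite cu1 cu2 Sa Sb -gE !eqxx.
Qed.

End UnionOfParts.

(** Each condition on an element [(h, x)] of the second group is checked on some
[(g, x)] of the first with the same label, which exists as every part is
inhabited. Cardinality is the difference count at the identity. *)
Lemma pds_union_of_parts_transfer (gT hT kT : finGroupType) (n : nat)
    (P : 'I_n -> {set gT}) (Q : 'I_n -> {set hT})
    (c : gT -> option 'I_n) (d : hT -> option 'I_n)
    (m : int) (s : 'I_n -> int) (S : {set option 'I_n * kT})
    (v k lambda mu : nat) :
  (forall a x, (x \in part P a) = (c x == a)) ->
  (forall a, exists x, c x = a) ->
  (forall i, signed_square_type m (s i) (P i)) ->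
  (forall a x, (x \in part Q a) = (d x == a)) ->
  (forall a, exists x, d x = a) ->
  (forall i, signed_square_type m (s i) (Q i)) ->
  pds (union_of_parts P S) v k lambda mu ->
  pds (union_of_parts Q S) v k lambda mu.
Proof.
move=> partE c_surj typeP partF d_surj typeQ.
have eq_count g h x : c g = d h ->
    diff_count (union_of_parts P S) (g, x) =
    diff_count (union_of_parts Q S) (h, x).
  move=> gh; rewrite (diff_count_union_of_parts partE).
  rewrite (diff_count_union_of_parts partF); apply: eq_bigr => st _.
  apply/eqP; rewrite -eqz_nat (pair_count_part partE c_surj typeP).
  by rewrite (pair_count_part partF d_surj typeQ) gh.
have c1 : c 1%g = None by apply/eqP; rewrite (label_eq_None partE).
have d1 : d 1%g = None by apply/eqP; rewrite (label_eq_None partF).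
have inD := mem_union_of_parts partE S; have inE' := mem_union_of_parts partF S.
have cV := label_invg partE typeP; have dV := label_invg partF typeQ.
have cardGH : #|gT| = #|hT|.
  rewrite (labelled_card partE) (labelled_card partF); congr (1 + _)%N.
  apply: eq_bigr => i _; apply/eqP.
  by rewrite -eqz_nat (square_type_card typeP) (square_type_card typeQ).
have eq_one g h (x : kT) : c g = d h ->
    ((g, x) == 1%g) = ((h, x) == 1%g).
  move=> gh; rewrite -![_ == 1%g]/((_ == _) && (_ == _)) /=.
  by rewrite -(label_eq_None partE) gh (label_eq_None partF).
move=> [[vE kE lE uE] [D1 DV]]; split; [split|split].
- by rewrite -vE !cardsT !card_prod cardGH.
- by rewrite -kE -!pair_count1; symmetry; apply: eq_count; rewrite c1 d1.
- move=> [h x]; rewrite inE' => Shx hx1; have [g gh] := c_surj (d h).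
  rewrite -(eq_count g) //; apply: lE; first by rewrite inD /= gh.
  by rewrite (eq_one g h).
- move=> [h x]; rewrite inE' => Shx hx1; have [g gh] := c_surj (d h).
  rewrite -(eq_count g) //; apply: uE; first by rewrite inD /= gh.
  by rewrite (eq_one g h).
- by move: D1; rewrite inD inE' /= c1 d1.
apply/setP=> -[h x]; rewrite inE !inE' /= dV; have [g <-] := c_surj (d h).
by move/setP/(_ (g, x)): DV; rewrite inE !inD /= cV.
Qed.

(** * Labellings and types from the partitions *)

Lemma partition_family_inj (T : finType) (I : Type) (F : I -> {set T})
    (Q : {set {set T}}) (A : {set T}) :
  partition Q A -> injective F -> (forall i, F i \in Q) ->
  forall i j x, x \in F i -> x \in F j -> i = j.
Proof.
case/and3P=> _ tQ _ Finj FQ i j x Fi Fj; apply: Finj.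
by rewrite -(def_pblock tQ (FQ i) Fi) (def_pblock tQ (FQ j) Fj).
Qed.

Lemma labelling_exists (gT : finGroupType) (n : nat) (P : 'I_n -> {set gT}) :
  (forall i, 1%g \notin P i) ->
  (forall i j x, x \in P i -> x \in P j -> i = j) ->
  (forall x, x != 1%g -> exists i, x \in P i) ->
  (forall i, P i != set0) ->
  exists2 c : gT -> option 'I_n,
    forall a x, (x \in part P a) = (c x == a) & forall a, exists x, c x = a.
Proof.
move=> P1 Pinj Pcov Pn0; exists (fun x => [pick i | x \in P i]).
  move=> a x; case: pickP => [i Pi|noP].
    case: a => [j|] /=; first apply/idP/eqP => [Pj|[<-] //].
      by rewrite (Pinj _ _ _ Pi Pj).
    by rewrite inE; apply/eqP => x1; move: (P1 i); rewrite -x1 Pi.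
  case: a => [j|] /=; first by rewrite noP.
  rewrite inE; apply/eqP; case: (eqVneq x 1%g) => // /Pcov[i].
  by rewrite noP.
case=> [i|].
  have /set0Pn[x Pi] := Pn0 i; exists x.
  case: pickP => [j Pj|/(_ i)]; last by rewrite Pi.
  by rewrite (Pinj _ _ _ Pi Pj).
exists 1%g; case: pickP => // i Pi.
by move: (P1 i); rewrite Pi.
Qed.

(** The parameters [lambda] and [mu] of a set are determined only when the set,
respectively its complement in the nonidentity elements, is inhabited. For
[lambda] this is the assumption; when it fails for [mu], it fails for [E] too
by cardinality, so that any [mu] fits [E]. *)
Lemma same_parameters_signed_square_type (gT hT : finGroupType) (m s : int)
    (D : {set gT}) (E : {set hT}) (v k lambda mu : nat) :
  D != set0 -> pds D v k lambda mu -> pds E v k lambda mu ->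
  signed_square_type m s D -> signed_square_type m s E.
Proof.
move=> /set0Pn[x Dx] [[vD kD lD uD] [D1 _]] [[vE kE lE uE] regE].
case=> [v' [k' [l' [u' [[[vD' kD' lD' uD'] _] eqs]]]]].
exists v', k', l', u'; split=> //; split=> //.
have ll' : l' = lambda.
  have x1 : x != 1%g by apply: contraNneq D1 => <-.
  by rewrite -(lD' x Dx x1) lD.
rewrite ll'; split=> //; [by rewrite vE -vD | by rewrite kE -kD |].
move=> y Ey y1; rewrite uE //.
suff /set0Pn[z] : ~: (1%g |: D) != set0.
  by rewrite !inE negb_or => /andP[z1 Dz]; rewrite -(uD z Dz z1) uD'.
have [E1 _] := regE.
(* If [1 |: D] were everything, [y |: (1 |: E)] would be too large. *)
have := subset_leq_card (subsetT (y |: (1%g |: E))).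
rewrite vE -vD !cardsU1 !inE negb_or Ey y1 E1 kE -kD -cards_eq0 /=.
have := cardsC (1%g |: D); rewrite cardsU1 D1 -cardsT /=.
by case: #|~: _| => // <-; rewrite addn0 !add1n ltnn.
Qed.

(** The order of the group determines [m ^+ 2] and the type determines the sign
of [m]; hence one [m] serves for all parts. *)
Lemma common_signed_square_type (gT : finGroupType) (n : nat)
    (P : 'I_n -> {set gT}) :
  (forall i, latin_square_type (P i)) \/
  (forall i, negative_latin_square_type (P i)) ->
  exists m : int, exists s : 'I_n -> int,
    forall i, signed_square_type m (s i) (P i).
Proof.
suff common (e : int) : e ^+ 2 = 1 ->
    (forall i, exists r l : nat,
      signed_square_type (e * r%:Z) (e * l%:Z) (P i)) ->
    exists m : int, exists s : 'I_n -> int,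
      forall i, signed_square_type m (s i) (P i).
  case=> typeP; [apply: (common 1) => // i | apply: (common (-1)) => // i].
    by have [q [r [v [k [l [u [pdsP [vE kE lE uE]]]]]]]] := typeP i;
       exists q, r, v, k, l, u; rewrite !mul1r.
  have [q [r [v [k [l [u [pdsP [vE kE lE uE]]]]]]]] := typeP i.
  exists q, r, v, k, l, u; split=> //.
  by rewrite vE kE lE uE; split; ring.
move=> e2; case: n P => [|n] P typeP; first by exists 0, (fun=> 0); case.
have [q [_ [v [k [l [u [[[vG _ _ _] _] [vE _ _ _]]]]]]]] := typeP ord0.
exists (e * q%:Z); apply: (@fin_all_exists _ (fun=> int)
  (fun i s => signed_square_type (e * q%:Z) s (P i))) => i.
have [r [t typePi]] := typeP i; exists (e * t%:Z).
suff -> : q = r by [].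
have [v' [_ [_ [_ [[[vG' _ _ _] _] [vE' _ _ _]]]]]] := typePi.
move: vE; rewrite -vG vG' vE' !exprMn e2 !mul1r => /eqP.
by rewrite eqrXn2 // => /eqP[].
Qed.

Theorem theorem6p2
  (gT hT kT : finGroupType) (n : nat)
  (P : 'I_n -> {set gT}) (Phat : 'I_n -> {set hT})
  (P_inj : injective P)
  (P_partition :
    partition ([set 1%g] |: [set P i | i : 'I_n]) [set: gT])
  (P_type : (forall i, latin_square_type (P i)) \/
            (forall i, negative_latin_square_type (P i)))
  (Phat_inj : injective Phat)
  (Phat_partition :
    partition [set Phat i | i : 'I_n] [set x : hT | x != 1%g])
  (same_parameters : forall i, exists v k lambda mu : nat,
    pds (P i) v k lambda mu /\ pds (Phat i) v k lambda mu)
  (D : {set gT * kT}) (S : {set option 'I_n * kT})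
  (D_union : D = union_of_parts P S)
  (v k lambda mu : nat)
  (D_pds : pds D v k lambda mu) :
  pds (union_of_parts Phat S) v k lambda mu.
Proof.
have P1 i : 1%g \notin P i.
  by have [? [? [? [? [[_ []]]]]]] := same_parameters i.
have Phat1 i : 1%g \notin Phat i.
  by have [? [? [? [? [_ [_ []]]]]]] := same_parameters i.
have inP i : P i \in [set 1%g] |: [set P i | i : 'I_n].
  by rewrite inE imset_f // orbT.
have inPhat i : Phat i \in [set Phat i | i : 'I_n] by rewrite imset_f.
have Pn0 i : P i != set0.
  by case/and3P: P_partition => _ _; apply: contraNneq => <-.
have [c partE c_surj] : exists2 c : gT -> option 'I_n,
    forall a x, (x \in part P a) = (c x == a) & forall a, exists x, c x = a.
  apply: labelling_exists => // [i j x|x x1].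
    exact: (partition_family_inj P_partition).
  have : x \in cover ([set 1%g] |: [set P i | i : 'I_n]).
    by rewrite (cover_partition P_partition) inE.
  case/bigcupP=> A; rewrite inE => /orP[|/imsetP[i _ ->]]; last by exists i.
  by rewrite inE => /eqP -> /set1P x1'; rewrite x1' eqxx in x1.
have [d partF d_surj] : exists2 d : hT -> option 'I_n,
    forall a x, (x \in part Phat a) = (d x == a) & forall a, exists x, d x = a.
  apply: labelling_exists => // [i j x|x x1|i].
  - exact: (partition_family_inj Phat_partition).
  - have : x \in cover [set Phat i | i : 'I_n].
      by rewrite (cover_partition Phat_partition) inE.
    by case/bigcupP=> _ /imsetP[i _ ->]; exists i.
  by case/and3P: Phat_partition => _ _; apply: contraNneq => <-.
have [m [s typeP]] := common_signed_square_type P_type.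
have typePhat i : signed_square_type m (s i) (Phat i).
  have [? [? [? [? [pdsP pdsPhat]]]]] := same_parameters i.
  exact: same_parameters_signed_square_type (Pn0 i) pdsP pdsPhat (typeP i).
rewrite D_union in D_pds.
exact: (pds_union_of_parts_transfer partE c_surj typeP partF d_surj typePhat).
Qed.
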